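(* The set of normal axiomatic extensions of the modal logic \(\mathbf{KTB}\) that have codimension \(3\) (in the lattice \(\mathrm{NExt}(\mathbf{KTB})\)) has cardinality of the continuum, \(2^{\aleph_0}\).
   Context: \(\mathbf{KTB}\) is the normal modal logic \(\mathbf{K}\) extended by the axioms \(p\to\Diamond p\) (T) and \(p\to\Box\Diamond p\) (B); its Kripke frames are the reflexive symmetric frames. \(\mathrm{NExt}(\mathbf{KTB})\) is the lattice of normal modal logics containing \(\mathbf{KTB}\) (sets of formulas containing \(\mathbf{KTB}\), closed under modus ponens, uniform substitution and necessitation), identified with their sets of theorems and ordered by inclusion. A logic \(L\) has codimension \(n\) in this lattice if there is a chain \(L_0\supsetneq L_1\supsetneq\dots\supsetneq L_n\) of logics in \(\mathrm{NExt}(\mathbf{KTB})\) such that \(L_0\) is the inconsistent logic (the set of all formulas), \(L_n=L\), and \(L_{i-1}\) covers \(L_i\) (there is no logic strictly between them) for each \(i\in\{1,\dots,n\}\). *)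

(* Defs.v *)
From mathcomp Require Import all_boot.
From mathcomp Require Import boolp classical_sets functions cardinality.

Set Implicit Arguments.
Unset Strict Implicit.
Unset Printing Implicit Defensive.

Local Open Scope classical_set_scope.

Inductive form : Type :=
| Var of nat
| Bot
| Imp of form & form
| Box of form.

Definition Neg (A : form) : form := Imp A Bot.
Definition Dia (A : form) : form := Neg (Box (Neg A)).

Fixpoint fsubst (s : nat -> form) (A : form) : form :=
  match A with
  | Var n => s n
  | Bot => Bot
  | Imp B C => Imp (fsubst s B) (fsubst s C)
  | Box B => Box (fsubst s B)
  end.

(* Boxed formulas are treated as propositional atoms, so [tautology] is the
   set of substitution instances of classical propositional tautologies. *)
Fixpoint prop_eval (v : form -> bool) (A : form) : bool :=
  match A with
  | Bot => false
  | Imp B C => prop_eval v B ==> prop_eval v C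
  | Var _ | Box _ => v A
  end.

Definition tautology : set form :=
  [set A | forall v : form -> bool, prop_eval v A].

Definition axK : form :=
  Imp (Box (Imp (Var 0) (Var 1))) (Imp (Box (Var 0)) (Box (Var 1))).
Definition axT : form := Imp (Var 0) (Dia (Var 0)).
Definition axB : form := Imp (Var 0) (Box (Dia (Var 0))).

Definition mp_closed (L : set form) : Prop :=
  forall A B, L (Imp A B) -> L A -> L B.
Definition subst_closed (L : set form) : Prop :=
  forall (s : nat -> form) A, L A -> L (fsubst s A).
Definition nec_closed (L : set form) : Prop :=
  forall A, L A -> L (Box A).

Definition normal_logic (L : set form) : Prop :=
  [/\ tautology `<=` L, L axK, mp_closed L, subst_closed L & nec_closed L].

Definition KTB : set form := smallest normal_logic [set axT; axB].

Definition NExtKTB : set (set form) :=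
  [set L | [/\ KTB `<=` L, mp_closed L, subst_closed L & nec_closed L]].

Definition covers (L1 L2 : set form) : Prop :=
  L2 `<` L1 /\ ~ exists L, [/\ NExtKTB L, L2 `<` L & L `<` L1].

(* Only the values C 0, ..., C n matter; [setT] is the inconsistent logic. *)
Definition has_codimension (n : nat) (L : set form) : Prop :=
  exists C : nat -> set form,
    [/\ C 0 = setT,
        C n = L,
        forall i, i <= n -> NExtKTB (C i)
      & forall i, i < n -> covers (C i) (C i.+1)].

(* Main.v *)
Require Import Defs.
From HB Require Import structures.
From mathcomp Require Import all_boot zify.
From mathcomp Require Import boolp classical_sets functions cardinality.

Set Implicit Arguments.
Unset Strict Implicit.
Unset Printing Implicit Defensive.

Local Open Scope classical_set_scope.
Local Open Scope card_scope.

(** The chain below the inconsistent logic is [Triv] (one reflexive point),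
    [LK2] (two points, total relation) and the logic of a general frame on an
    infinite graph whose admissible sets are those definable from a single
    vertex [tip].

    A logic [M] covers [logic_of R {tip}] as soon as the frame has bounded
    diameter and, for every theorem [B] of [M], [{tip}] is defined by one of
    finitely many formulas in every valuation refuting [B]: a formula [A]
    outside [logic_of R {tip}] is then refuted, after substitution, wherever [B]
    is, so [A] yields [B].

    In the graph a pendant path tip - mid - hub with a leaf at the hub forces
    tip, mid, hub and leaf into four distinct classes of every quotient with
    more than two points, and the pendant paths of length two at the core
    vertices keep every other vertex out of these classes. So any valuation
    distinguishing three kinds of points defines [{tip}], whatever graph is put
    on the core.
    A set [X] of naturals is written into the core as paths of length [n + 2]
    whose starting point is marked when [n] is in [X]; as one formula
    characterises [{tip}], the logic of the graph determines [X]. *)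

(** * Formulas and general frames *)

(** This injection gives formulas decidable equality, and later bounds the number of logics by that
    of sets of naturals. *)
Fixpoint form_code (A : form) : nat :=
  match A with
  | Var n => CodeSeq.code [:: 0; n]
  | Bot => CodeSeq.code [:: 1]
  | Imp B C => CodeSeq.code [:: 2; form_code B; form_code C]
  | Box B => CodeSeq.code [:: 3; form_code B]
  end.

Lemma form_code_inj : injective form_code.
Proof.
have inj := can_inj CodeSeq.codeK.
elim=> [n||B IHB C IHC|B IHB] [n'||B' C'|B'] /inj //.
- by case=> ->.
- by case=> /IHB -> /IHC ->.
- by case=> /IHB ->.
Qed.

HB.instance Definition _ := Equality.copy form (inj_type form_code_inj).

Definition Top : form := Neg Bot.
Definition And (A B : form) : form := Neg (Imp A (Neg B)).
Definition Or (A B : form) : form := Imp (Neg A) B.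

Section Semantics.
Variables (V : Type) (R : V -> V -> Prop).
Implicit Types (e : nat -> V -> Prop) (A B : form) (x y : V).

Fixpoint sat e A : V -> Prop :=
  match A with
  | Var n => e n
  | Bot => fun=> False
  | Imp B C => fun x => sat e B x -> sat e C x
  | Box B => fun x => forall y, R x y -> sat e B y
  end.

Lemma sat_subst e s A : sat e (fsubst s A) = sat (fun n => sat e (s n)) A.
Proof. by elim: A => //= [B -> C ->|B ->]. Qed.

Lemma satDia e A x : sat e (Dia A) x <-> exists2 y, R x y & sat e A y.
Proof.
split=> [h|[y xy Ay] /(_ y xy)]; last exact.
by apply: contrapT => h'; apply: h => y xy Ay; apply: h'; exists y.
Qed.

Lemma satNeg e A x : sat e (Neg A) x = ~ sat e A x.
Proof. by []. Qed.

Lemma satAnd e A B x : sat e (And A B) x <-> sat e A x /\ sat e B x.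
Proof.
split=> [h|[? ?] /=]; last by apply.
by split; apply: contrapT => h'; apply: h => /= ? ?; apply: h'.
Qed.

Lemma satOr e A B x : sat e (Or A B) x <-> sat e A x \/ sat e B x.
Proof.
split=> [h|[|] //=].
by have [?|/h] := pselect (sat e A x); [left|right].
Qed.

Lemma sat_iterBox_all e n A x :
  (forall y, sat e A y) -> sat e (iter n Box A) x.
Proof. by move=> hA; elim: n x => [|n IHn] x //= y _; exact: IHn. Qed.

(* The logic of the general frame whose admissible sets are those definable
   from [G]. *)
Definition logic_of (G : V -> Prop) : set form :=
  [set A | forall s x, sat (fun=> G) (fsubst s A) x].

Lemma logic_of_NExtKTB G :
    (forall x, R x x) -> (forall x y, R x y -> R y x) -> NExtKTB (logic_of G).
Proof.
move=> Rxx Rsym.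
have mp : mp_closed (logic_of G) by move=> A B AB hA s x; exact: AB (hA s x).
have sub : subst_closed (logic_of G).
  move=> s A hA s' x; rewrite sat_subst.
  have := hA (fun n => fsubst s' (s n)) x; rewrite !sat_subst.
  by congr (sat _ _ _); apply: funext => n; rewrite sat_subst.
have nec : nec_closed (logic_of G) by move=> A hA s x y _; exact: hA.
split=> // A; apply; split.
  split=> // [B tautB s x|s x /= h h0 y xy]; last exact: h (h0 y xy).
  (* Truth at [x] is a Boolean valuation with variables and boxed formulas as atoms, so tautologies
     hold. *)
  have /= h C : reflect (sat (fun=> G) (fsubst s C) x)
      (prop_eval (fun D => `[< sat (fun=> G) (fsubst s D) x >]) C).
    elim: C => [n||C IHC D IHD|C IHC] /=; try exact: asboolP.
      by apply: ReflectF.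
    by apply: (iffP implyP) => h /IHC /h /IHD.
  exact/h/tautB.
move=> _ [->|->] s x /=.
  by move=> sx /(_ x (Rxx x)); apply.
by move=> sx y xy /(_ x (Rsym _ _ xy)); apply.
Qed.

End Semantics.

Arguments sat {V}.
Arguments logic_of {V}.

(** * Criteria for covering and for inclusion *)

Lemma covers_of_deduction (M1 M2 : set form) :
    M2 `<` M1 ->
    (forall A B, ~ M2 A -> M1 B -> exists (ss : seq (nat -> form)) n,
      M2 (foldr (fun s => Imp (iter n Box (fsubst s A))) B ss)) ->
  covers M1 M2.
Proof.
move=> M21 ded; split=> // -[L [[_ mp sub nec] [M2L nLM2] [_ nM1L]]].
apply: nM1L => B M1B.
have [A LA nM2A] : exists2 A, L A & ~ M2 A.
  apply: contrapT => h; apply: nLM2 => A LA.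
  by apply: contrapT => nM2A; apply: h; exists A.
have [ss [n /M2L]] := ded _ _ nM2A M1B.
(* Each antecedent is a necessitated instance of [A], hence in [L], so modus ponens strips them all
   and puts [B] in [L]. *)
elim: ss => //= s ss IH h; apply: IH; apply: mp h _.
by elim: n => [|n IH] /=; [exact: sub|exact: nec].
Qed.

Lemma covers_logic_of (V : Type) (R : V -> V -> Prop) (G : V -> Prop) n
    (M : set form) :
    (forall e A x y, sat R e (iter n Box A) x -> sat R e A y) ->
    logic_of R G `<` M ->
    (forall B, M B -> exists T : seq form, forall e x, ~ sat R e B x ->
      exists2 t, t \in T & sat R e t = G) ->
  covers M (logic_of R G).
Proof.
move=> Rn ltM hT; apply: covers_of_deduction => // A B nA /hT [T TP].
have [s [x nsAx]] : exists s x, ~ sat R (fun=> G) (fsubst s A) x.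
  apply: contrapT => h; apply: nA => s x; apply: contrapT => h'.
  by apply: h; exists s, x.
(* One antecedent per candidate [t]: if [t] defines [G], the substitution recreates the valuation
   refuting [A], and [iter n Box] acts as a universal modality. *)
exists [seq (fun k => fsubst (fun=> t) (s k)) | t <- T], n => s' x'.
rewrite sat_subst; set e := (fun k => sat R _ _).
apply: contrapT => nB.
have [nBx nT] : ~ sat R e B x' /\ forall t, t \in T ->
    sat R e (iter n Box (fsubst (fun k => fsubst (fun=> t) (s k)) A)) x'.
  elim: T nB {TP} => [//|t T IH] /= nB.
  have {}/IH [? IH] := fun h => nB (fun=> h).
  split=> // t'; rewrite inE => /predU1P[->|/IH//].
  by apply: contrapT => h; apply: nB.
have [t tT tG] := TP _ _ nBx; apply: nsAx.
have := Rn _ _ _ x (nT _ tT); rewrite !sat_subst.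
by congr (sat _ _ _ _); apply: funext => k; rewrite sat_subst tG.
Qed.

(** A surjective p-morphism pulls refutations back; as [D] defines the preimage of [G'], valuations
    definable from [G'] pull back to valuations definable from [G]. *)
Lemma logic_of_pmorphism (V V' : Type) (R : V -> V -> Prop)
    (R' : V' -> V' -> Prop) (G : V -> Prop) (G' : V' -> Prop) (h : V -> V')
    (D : form) :
    (forall x y, R x y -> R' (h x) (h y)) ->
    (forall x y', R' (h x) y' -> exists2 y, R x y & h y = y') ->
    (forall x', exists x, h x = x') ->
    (forall x, sat R (fun=> G) D x <-> G' (h x)) ->
  logic_of R G `<=` logic_of R' G'.
Proof.
move=> forth back surj hD A LA s x'; have [x <-] := surj x'.
have sath B y : sat R' (fun=> G') B (h y) <-> sat R (fun=> G' \o h) B y.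
  elim: B y => //= [B IHB C IHC|B IHB] y; first by rewrite IHB IHC.
  split=> [hB y' yy'|hB y' /back[y0 yy0 <-]]; apply/IHB; apply: hB => //.
  exact: forth.
apply/sath; have := LA (fun n => fsubst (fun=> D) (s n)) x.
rewrite !sat_subst; congr (sat _ _ _ _); apply: funext => n.
rewrite sat_subst; congr (sat _ _ _); apply: funext => _; apply: funext => y.
exact/propext.
Qed.

(** * The logics of codimension one and two *)

Fixpoint vars (A : form) : seq nat :=
  match A with
  | Var n => [:: n]
  | Bot => [::]
  | Imp B C => vars B ++ vars C
  | Box B => vars B
  end.

Fixpoint depth (A : form) : nat :=
  match A with
  | Var _ | Bot => 0
  | Imp B C => maxn (depth B) (depth C)
  | Box B => (depth B).+1
  end.

Definition full_rel {V : Type} (_ _ : V) : Prop := True.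

Definition Triv : set form := logic_of (@full_rel unit) (fun=> False).
Definition LK2 : set form := logic_of (@full_rel bool) is_true.

(** All four subsets of the two-point frame are definable from [{true}], so arbitrary valuations are
    covered. *)
Lemma LK2_sat (e : nat -> bool -> Prop) A b : LK2 A -> sat full_rel e A b.
Proof.
pose s n := if `[< e n true >]
  then if `[< e n false >] then Top else Var 0
  else if `[< e n false >] then Neg (Var 0) else Bot.
move=> /(_ s b); rewrite sat_subst; congr (sat _ _ _ _).
apply: funext => n; apply: funext => c; apply/propext; rewrite /s.
by case: asboolP; case: asboolP => h1 h2; case: c => //=; split => // /(_ isT).
Qed.

Lemma Triv_sat (e : nat -> unit -> Prop) A u : Triv A -> sat full_rel e A u.
Proof.
pose s n := if `[< e n tt >] then Top else Bot.
move=> /(_ s u); rewrite sat_subst; congr (sat _ _ _ _).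
apply: funext => n; apply: funext => -[]; apply/propext; rewrite /s.
by case: asboolP => h; split=> //=.
Qed.

Lemma covers_setT_Triv : covers setT Triv.
Proof.
apply: (@covers_logic_of _ _ _ 0) => [e A [] []|| B _] //.
  by split=> // h; exact: (h Bot I Var tt).
by exists [:: Bot] => e x _; exists Bot; rewrite ?inE.
Qed.

Lemma LK2_proper_Triv : LK2 `<` Triv.
Proof.
split.
  apply: (@logic_of_pmorphism _ _ _ _ _ _ (fun=> tt) Bot) => //.
    by move=> x []; exists true.
  by case; exists true.
move=> /(_ (Imp (Var 0) (Box (Var 0)))) h.
have /h/LK2_sat : Triv (Imp (Var 0) (Box (Var 0))).
  by move=> s [] /= + [].
by move=> /(_ (fun=> is_true) true isT false I).
Qed.

Lemma covers_Triv_LK2 : covers Triv LK2.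
Proof.
apply: (@covers_logic_of _ _ _ 1); [|exact: LK2_proper_Triv|].
  by move=> e A x y /= /(_ y I).
move=> B TB; exists (map Var (vars B) ++ map (Neg \o Var) (vars B)) => e x nBx.
(* If no variable of [B] separated the two points, [B] could be evaluated on the one-point frame,
   where it holds. A separating variable or its negation defines the point [true]. *)
have [n nB nen] : exists2 n, n \in vars B & ~ (e n true <-> e n false).
  apply: contrapT => h; apply: nBx.
  have eqe n b : n \in vars B -> (e n b <-> e n x).
    move=> nB; have : e n true <-> e n false.
      by apply: contrapT => ?; apply: h; exists n.
    by case: b; case: x => // ->.
  have : sat full_rel (fun n (_ : unit) => e n x) B tt by exact: Triv_sat.
  suff: forall A (b : bool), {subset vars A <= vars B} ->
      (sat full_rel e A b <-> sat full_rel (fun n (_ : unit) => e n x) A tt).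
    by move=> /(_ B x) ->.
  elim=> [n||A IHA C IHC|A IHA] b sub //=.
  - by apply: eqe; apply: sub; rewrite inE.
  - rewrite IHA ?IHC // => n nA; apply: sub; rewrite /= mem_cat nA ?orbT //.
  - split=> [h' [] _|h' y _]; last by rewrite IHA //; exact: h'.
    by rewrite -(IHA b) //; exact: h'.
have [h1|h1] := pselect (e n true).
  exists (Var n); first by rewrite mem_cat map_f.
  apply: funext => -[]; apply/propext; split=> //= h2.
  by case: nen.
exists (Neg (Var n)); first by rewrite mem_cat (map_f (Neg \o Var)) ?orbT.
apply: funext => -[]; apply/propext; split=> //= h2.
by case: nen.
Qed.

(** * Modal equivalence of bounded depth *)

(** Conjunctions deciding every member of [F]; the one true at a point defines the class of points
    agreeing with it on [F]. *)
Fixpoint cells (F : seq form) : seq form :=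
  match F with
  | [::] => [:: Top]
  | A :: F' => map (And A) (cells F') ++ map (And (Neg A)) (cells F')
  end.

Lemma cellP (V : Type) (R : V -> V -> Prop) e F x :
  exists2 c, c \in cells F &
    forall y, sat R e c y <->
      forall A, A \in F -> (sat R e A y <-> sat R e A x).
Proof.
elim: F => [|A F [c cF cP]] /=.
  by exists Top => [|y]; [rewrite inE|split=> [_ A|_]].
have key B : (forall y, sat R e B y <-> (sat R e A y <-> sat R e A x)) ->
    forall y, sat R e (And B c) y <->
      forall A', A' \in A :: F -> (sat R e A' y <-> sat R e A' x).
  move=> BP y; rewrite satAnd cP BP; split=> [[h1 h2] A'|h].
    by rewrite inE => /predU1P[->|/h2].
  by split=> [|A' A'F]; apply: h; rewrite inE ?eqxx ?A'F ?orbT.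
have [Ax|nAx] := pselect (sat R e A x).
  exists (And A c); first by rewrite mem_cat map_f.
  by apply: key => y; split=> [|h]; [split|apply/h].
exists (And (Neg A) c); first by rewrite mem_cat (map_f (And (Neg A))) ?orbT.
by apply: key => y /=; split=> [h|-> //]; split.
Qed.

(* Every formula of modal depth at most [k] over the variables [vs] is a
   Boolean combination of members of [rank_forms vs k]. *)
Fixpoint rank_forms (vs : seq nat) (k : nat) : seq form :=
  match k with
  | 0 => map Var vs
  | k'.+1 => rank_forms vs k' ++ map Dia (cells (rank_forms vs k'))
  end.

Section RankEquivalence.
Variables (V : Type) (R : V -> V -> Prop) (e : nat -> V -> Prop) (vs : seq nat).

Definition rank_eqv k x y :=
  forall A, A \in rank_forms vs k -> (sat R e A x <-> sat R e A y).

Lemma rank_eqv_sym k x y : rank_eqv k x y -> rank_eqv k y x.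
Proof. by move=> h A /h ->. Qed.

Lemma rank_eqv_trans k x y t :
  rank_eqv k x y -> rank_eqv k y t -> rank_eqv k x t.
Proof. by move=> h1 h2 A AF; rewrite h1 // h2. Qed.

Lemma rank_eqv_le j k x y : j <= k -> rank_eqv k x y -> rank_eqv j x y.
Proof.
move=> /subnK <-; elim: (k - j) => //= i IH h; apply: IH => A AF.
by apply: h; rewrite addSn /= mem_cat AF.
Qed.

(** The cell of [x'] at level [k] is one formula, and its [Dia] belongs to level [k.+1]. *)
Lemma rank_eqv_step k x y x' :
  rank_eqv k.+1 x y -> R x x' -> exists2 y', R y y' & rank_eqv k x' y'.
Proof.
move=> h xx'; have [c cF cP] := cellP R e (rank_forms vs k) x'.
have /satDia[y' yy' /cP y'P] : sat R e (Dia c) y.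
  apply/(h (Dia c)); first by rewrite /= mem_cat map_f ?orbT.
  by apply/satDia; exists x' => //; apply/cP.
by exists y' => // A AF; rewrite y'P.
Qed.

End RankEquivalence.

(** * The graphs and their rigidity *)

Inductive vertex (W : Type) : Type :=
| tip | mid | hub | leaf
| core of W
| stem of W
| bud of W.

Arguments tip {W}.
Arguments mid {W}.
Arguments hub {W}.
Arguments leaf {W}.

(* Drawn without loops: the path tip - mid - hub - leaf, every core vertex
   joined to the hub, and a path core a - stem a - bud a hanging from every
   core vertex; [mark a] adds the edge hub - stem a. *)
Definition adj (W : Type) (E : W -> W -> Prop) (mark : W -> bool)
    (x y : vertex W) : Prop :=
  match x, y with
  | tip, tip | tip, mid | mid, tip | mid, mid | mid, hub | hub, mid
  | hub, hub | hub, leaf | leaf, hub | leaf, leaf => True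
  | hub, core _ | core _, hub => True
  | hub, stem a | stem a, hub => mark a
  | core a, core b => E a b
  | core a, stem b | stem a, core b | stem a, stem b
  | stem a, bud b | bud a, stem b | bud a, bud b => a = b
  | _, _ => False
  end.

Section Gadget.
Variables (W : Type) (E : W -> W -> Prop) (mark : W -> bool).
Hypothesis Exx : forall a, E a a.
Hypothesis Esym : forall a b, E a b -> E b a.

Local Notation V := (vertex W).
Local Notation adj := (adj E mark).
Implicit Types (x y : V) (a b : W).

Definition is_tip x := x = tip.

Lemma adjxx x : adj x x.
Proof. by case: x. Qed.

Lemma adj_sym x y : adj x y -> adj y x.
Proof. by case: x => [||||a|a|a]; case: y => [||||b|b|b] //=; exact: Esym. Qed.

(** The farthest vertices, the buds, reach the hub through stem and core; loops pad shorter paths to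
    length three. *)
Lemma sat_iterBox_hub e A x :
  (sat adj e (iter 3 Box A) x -> sat adj e A hub) /\
  (sat adj e (iter 3 Box A) hub -> sat adj e A x).
Proof.
have path3 y y' y'' : adj x y -> adj y y' -> adj y' y'' ->
    sat adj e (iter 3 Box A) x -> sat adj e A y''.
  by move=> h1 h2 h3 /= /(_ _ h1 _ h2 _ h3).
have path3' y y' : adj hub y -> adj y y' -> adj y' x ->
    sat adj e (iter 3 Box A) hub -> sat adj e A x.
  by move=> h1 h2 h3 /= /(_ _ h1 _ h2 _ h3).
case: x path3 path3' => [||||a|a|a] p p'; split.
- exact: (p mid hub).
- exact: (p' mid tip).
- exact: (p hub hub).
- exact: (p' hub mid).
- exact: (p hub hub).
- exact: (p' hub hub).
- exact: (p hub hub).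
- exact: (p' hub leaf).
- exact: (p hub hub).
- exact: (p' hub (core a)).
- exact: (p (core a) hub).
- exact: (p' (core a) (stem a)).
- exact: (p (stem a) (core a)).
- exact: (p' (core a) (stem a)).
Qed.

Lemma sat_iterBox e A x y : sat adj e (iter 6 Box A) x -> sat adj e A y.
Proof.
rewrite (iterD 3 3) => /(proj1 (sat_iterBox_hub _ _ _)).
exact: (proj2 (sat_iterBox_hub _ _ _)).
Qed.

(** * Rigidity of the tip under graded bisimulation *)

Section Rigidity.
Variable eqv : nat -> V -> V -> Prop.
Hypothesis eqv_refl : forall k x, eqv k x x.
Hypothesis eqv_sym : forall k x y, eqv k x y -> eqv k y x.
Hypothesis eqv_trans : forall k x y t, eqv k x y -> eqv k y t -> eqv k x t.
Hypothesis eqv_le : forall j k x y, j <= k -> eqv k x y -> eqv j x y.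
Hypothesis eqv_back : forall k x y x',
  eqv k.+1 x y -> adj x x' -> exists2 y', adj y y' & eqv k x' y'.

Let eqv_forth k x y y' :
  eqv k.+1 x y -> adj y y' -> exists2 x', adj x x' & eqv k x' y'.
Proof.
by move=> /eqv_sym/eqv_back/[apply] -[x' xx' /eqv_sym ?]; exists x'.
Qed.

(** The neighbours of [tip] and [mid] are [tip], [mid] and [hub], so resembling [tip] or [mid]
    spreads along edges, losing one level per step; three steps from the hub reach every vertex. *)
Lemma collapse k x :
  eqv (3 + k) hub tip \/ eqv (3 + k) hub mid -> eqv k x tip \/ eqv k x mid.
Proof.
move=> hubP.
have hubP' j : j <= 3 -> eqv (j + k) hub tip \/ eqv (j + k) hub mid.
  move=> j3; case: hubP => /eqv_le h; [left|right]; apply: h;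
    by rewrite leq_add2r.
have step j y y' : j <= 3 -> eqv (j + k).+1 y tip \/ eqv (j + k).+1 y mid ->
    adj y y' -> eqv (j + k) y' tip \/ eqv (j + k) y' mid.
  move=> j3 [] /eqv_back/[apply] -[t]; case: t => //= _ h; try by [left|right].
  by case: (hubP' j j3) => h'; [left|right]; exact: eqv_trans h h'.
have coreP a : eqv (2 + k) (core a) tip \/ eqv (2 + k) (core a) mid.
  exact: (@step 2 hub).
have stemP a : eqv (1 + k) (stem a) tip \/ eqv (1 + k) (stem a) mid.
  exact: (@step 1 (core a)).
case: x => [||||a|a|a]; [by left|by right|exact: (hubP' 0)|..].
- by apply: (@step 0 hub) => //; exact: (hubP' 1).
- by case: (coreP a) => /eqv_le h; [left|right]; apply: h; rewrite leq_addl.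
- by case: (stemP a) => /eqv_le h; [left|right]; apply: h; rewrite leq_addl.
- exact: (@step 0 (stem a)).
Qed.

Hypothesis hub_tip : ~ eqv 0 hub tip.
Hypothesis hub_mid : ~ eqv 0 hub mid.

Let separated x y : bool :=
  match x, y with
  | tip, (mid | hub | leaf) | mid, (tip | hub | leaf)
  | hub, (tip | mid | leaf) | leaf, (tip | mid | hub) => true
  | _, _ => false
  end.

(** Beyond the two hypotheses on the hub, one vertex of each pair sees an anchor that no neighbour
    of the other can match, by the pairs settled before. *)
Let anchors_separated x y : separated x y -> ~ eqv 3 x y.
Proof.
have hub_tip' k : ~ eqv k hub tip by move=> /(eqv_le (leq0n k)).
have hub_mid' k : ~ eqv k hub mid by move=> /(eqv_le (leq0n k)).
have tip_mid : ~ eqv 1 tip mid.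
  by move=> /eqv_forth /(_ (I : adj mid hub))[[]] //= _ /eqv_sym.
have leaf_tip : ~ eqv 1 leaf tip.
  by move=> /eqv_back /(_ (I : adj leaf hub))[[]].
have leaf_mid : ~ eqv 2 leaf mid.
  by move=> /eqv_forth /(_ (I : adj mid tip))[[]] //= _ /hub_tip'.
have leaf_hub : ~ eqv 3 leaf hub.
  by move=> /eqv_forth /(_ (I : adj hub mid))[[]] //= _ /hub_mid'.
have up j t t' : ~ eqv j t t' -> j <= 3 -> ~ eqv 3 t t' /\ ~ eqv 3 t' t.
  by move=> h j3; split=> [|/eqv_sym] /(eqv_le j3).
have [? ?] := up _ _ _ hub_tip isT; have [? ?] := up _ _ _ hub_mid isT.
have [? ?] := up _ _ _ tip_mid isT; have [? ?] := up _ _ _ leaf_tip isT.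
have [? ?] := up _ _ _ leaf_mid isT; have [? ?] := up _ _ _ leaf_hub isT.
by case: x; case: y.
Qed.

Let clash i j x y y' : 2 < i -> 2 < j -> separated y y' ->
  eqv i x y -> eqv j x y' -> False.
Proof.
move=> i3 j3 /anchors_separated sep /(eqv_le i3)/eqv_sym h /(eqv_le j3) h'.
exact/sep/(eqv_trans h h').
Qed.

(** [mid] sees three separated anchors, [tip], [mid] and [hub], but a bud has only two neighbours,
    itself and its stem. *)
Lemma bud_neq_mid a : ~ eqv 4 (bud a) mid.
Proof.
move=> h.
have [[] //= b ab ht] := eqv_forth h (I : adj mid tip); last first.
  by subst b; exact: clash ht h.
have [[] //= c ac hh] := eqv_forth h (I : adj mid hub); subst.
  exact: clash ht hh.
exact: clash h hh.
Qed.

Lemma bud_neq_hub a : ~ eqv 4 (bud a) hub.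
Proof.
move=> h.
have [[] //= b ab ht] := eqv_forth h (I : adj hub mid); last first.
  by subst b; exact: clash ht h.
have [[] //= c ac hh] := eqv_forth h (I : adj hub leaf); subst.
  exact: clash ht hh.
exact: clash h hh.
Qed.

Lemma stem_neq_leaf a : ~ eqv 5 (stem a) leaf.
Proof.
move=> h; have [[] //= _ h1] := eqv_back h (erefl : adj (stem a) (bud a)).
  exact: bud_neq_hub h1.
have [[] //= c ac hh] := eqv_forth h1 (I : adj leaf hub); subst.
  exact: clash h hh.
exact: clash h1 hh.
Qed.

Lemma stem_neq_tip a : ~ eqv 5 (stem a) tip.
Proof.
move=> h; have [[] //= _ h1] := eqv_back h (erefl : adj (stem a) (bud a));
  last exact: bud_neq_mid h1.
have [[] //= c ac hh] := eqv_forth h1 (I : adj tip mid); subst.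
  exact: clash h hh.
exact: clash h1 hh.
Qed.

Lemma core_neq_tip k a : ~ eqv k.+1 (core a) tip.
Proof.
move=> h; have [[] //= _ h1] := eqv_back h (I : adj (core a) hub).
  exact/hub_tip/(eqv_le (leq0n k)).
exact/hub_mid/(eqv_le (leq0n k)).
Qed.

Lemma core_neq_leaf a : ~ eqv 6 (core a) leaf.
Proof.
move=> h; have [[] //= _ h1] := eqv_back h (erefl : adj (core a) (stem a));
  last exact: stem_neq_leaf h1.
have [[||||b|b|b] //= hb hm] := eqv_forth h1 (I : adj hub mid); subst.
- exact/hub_mid/(eqv_le (leq0n 4)).
- exact: clash h hm.
- exact: clash h1 hm.
- exact: bud_neq_mid hm.
Qed.

Lemma core_neq_mid a : ~ eqv 6 (core a) mid.
Proof.
move=> h; have [[||||b|b|b] //= hb ht] := eqv_forth h (I : adj mid tip).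
- exact/hub_tip/(eqv_le (leq0n 5)).
- exact: core_neq_tip ht.
- exact: stem_neq_tip ht.
Qed.

Lemma core_neq_hub a : ~ eqv 7 (core a) hub.
Proof.
move=> h; have [[||||b|b|b] //= hb hl] := eqv_forth h (I : adj hub leaf).
- exact: clash (eqv_refl 3 _) hl.
- exact: core_neq_leaf hl.
- by apply: (@stem_neq_leaf b); apply: eqv_le hl.
Qed.

Lemma stem_neq_mid a : ~ eqv 8 (stem a) mid.
Proof.
move=> h; have [[] //= _ h1] := eqv_back h (erefl : adj (stem a) (core a)).
- exact: core_neq_tip h1.
- by apply: (@core_neq_mid a); apply: eqv_le h1.
- exact: core_neq_hub h1.
Qed.

Lemma tip_rigid x : eqv 9 x tip -> x = tip.
Proof.
case: x => [||||a|a|a] // h; exfalso.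
- exact: clash (eqv_refl 3 _) h.
- exact: clash (eqv_refl 3 _) h.
- exact: clash (eqv_refl 3 _) h.
- exact: core_neq_tip h.
- by apply: (@stem_neq_tip a); apply: eqv_le h.
- have [[||||b|b|b] //= hb hm] := eqv_forth h (I : adj tip mid).
    exact: stem_neq_mid hm.
  by subst; exact: clash h hm.
Qed.

End Rigidity.
End Gadget.

(** With [Var 0] read as the tip, these formulas define the vertices at distance one, two, three and
    four from it. *)
Definition f_mid := And (Dia (Var 0)) (Neg (Var 0)).
Definition f_hub := And (Dia f_mid) (And (Neg f_mid) (Neg (Var 0))).
Definition f_ring :=
  And (Dia f_hub) (And (Neg f_hub) (And (Neg f_mid) (Neg (Var 0)))).
Definition f_far := And (Dia f_ring) (And (Neg f_ring) (Neg f_hub)).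

(** * Codimension three of the gadget logics *)

Section Codimension.
Variables (W : Type) (E : W -> W -> Prop) (mark : W -> bool).
Hypothesis Exx : forall a, E a a.
Hypothesis Esym : forall a b, E a b -> E b a.

Local Notation V := (vertex W).
Local Notation adj := (adj E mark).
Implicit Types (x y : V) (a b : W).

Definition is_ring x : Prop :=
  match x with leaf | core _ => True | stem a => mark a | _ => False end.

Section Definability.
Variable e : nat -> V -> Prop.
Hypothesis e0 : e 0 = @is_tip W.

Lemma sat_tip : sat adj e (Var 0) = (fun x => x = tip).
Proof. exact: e0. Qed.

Lemma sat_mid : sat adj e f_mid = (fun x => x = mid).
Proof.
apply: funext => x; apply/propext; rewrite /f_mid satAnd satDia satNeg sat_tip.
split=> [[[y xy yt] nx]|->]; last by split=> //; exists tip.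
by move: xy nx; rewrite yt; case: x.
Qed.

Lemma sat_hub : sat adj e f_hub = (fun x => x = hub).
Proof.
apply: funext => x; apply/propext.
rewrite /f_hub !satAnd satDia satNeg sat_mid satNeg sat_tip.
split=> [[[y xy ym] nx]|->]; last by split; [exists mid|split].
by move: xy nx; rewrite ym; case: x => //= _ [].
Qed.

Lemma sat_ring : sat adj e f_ring = is_ring.
Proof.
apply: funext => x; apply/propext.
rewrite /f_ring !satAnd satDia satNeg sat_hub satNeg sat_mid satNeg sat_tip.
split=> [[[y xy yh] nx]|].
  by move: xy nx; rewrite yh; case: x => //= _ [] // ? [].
by case: x => [||||a|a|a] //= ma; (split; [exists hub|split]).
Qed.

Lemma sat_far :
  sat adj e f_far = (fun x =>
    match x with stem a => ~~ mark a | bud a => mark a | _ => False end).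
Proof.
apply: funext => x; apply/propext.
rewrite /f_far !satAnd satDia satNeg sat_ring satNeg sat_hub.
split=> [[[y xy ry] [nx nh]]|].
  move: xy ry nx nh; case: x => [||||a|a|a] //=; try by move=> *; exact/negP.
    by case: y.
  - by case: y.
  - by case: y => // b ->.
case: x => //= a ma; split.
- by exists (core a).
- by split=> //; exact/negP.
- by exists (stem a).
- by split.
Qed.

End Definability.

Definition gadget_logic : set form := logic_of adj (@is_tip W).

Lemma gadget_logic_NExtKTB : NExtKTB gadget_logic.
Proof. apply: logic_of_NExtKTB; [exact: adjxx|exact: adj_sym]. Qed.

Lemma gadget_logic_proper_LK2 : gadget_logic `<` LK2.
Proof.
split.
  (* The 2-colouring by the parity of the distance to [tip]. *)
  pose h x := match x with
    | tip | hub => true | mid | leaf | core _ => false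
    | stem a => ~~ mark a | bud a => mark a end.
  pose D := Or (Var 0) (Or f_hub f_far).
  apply: (@logic_of_pmorphism _ _ _ _ _ _ h D) => //.
  - move=> x y' _; have [->|] := eqVneq y' (h x).
      by exists x => //; exact: adjxx.
    move=> ny; have -> : y' = ~~ h x by case: y' (h x) ny => [] [].
    case: x {ny} => [||||a|a|a] /=.
    + by exists mid.
    + by exists hub.
    + by exists leaf.
    + by exists hub.
    + by exists hub.
    + by case ma: (mark a); [exists hub|exists (core a)].
    + by exists (stem a).
  - by case; [exists hub|exists mid].
  move=> x; rewrite !satOr sat_hub // sat_far //= /is_tip.
  split=> [[->|[->|]]|] //; case: x => //=; tauto.
(* Transitivity is valid for the total relation and fails at the hub, at distance two from the
   tip. *)
pose A4 := Imp (Dia (Dia (Var 0))) (Dia (Var 0)).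
move=> /(_ A4) h.
have /h /(_ Var hub) : LK2 A4.
  move=> s x; rewrite sat_subst; set e := fun n => _.
  change (sat full_rel e (Dia (Dia (Var 0))) x ->
    sat full_rel e (Dia (Var 0)) x).
  move=> /satDia[y _ /satDia[t _ ?]].
  by apply/satDia; exists t.
rewrite sat_subst => h4.
have /satDia[y hy yt] : sat adj (fun=> @is_tip W) (Dia (Var 0)) hub.
  apply: h4; change (sat adj (fun=> @is_tip W) (Dia (Dia (Var 0))) hub).
  by apply/satDia; exists mid => //; apply/satDia; exists tip.
by move: hy; rewrite yt.
Qed.

Lemma covers_LK2_gadget : covers LK2 gadget_logic.
Proof.
apply: (@covers_logic_of _ _ _ 6); [|exact: gadget_logic_proper_LK2|].
  by move=> e A x y; exact: sat_iterBox.
move=> B LB; set d := depth B; set vs := vars B.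
(* Levels: [d] to evaluate [B], three more for [collapse], nine more for [tip_rigid]. *)
exists (cells (rank_forms vs (9 + (3 + d)))) => e x nBx.
have [hubP|hubP] := pselect (rank_eqv adj e vs (3 + d) hub tip \/
                             rank_eqv adj e vs (3 + d) hub mid).
  (* Every vertex is now equivalent to [tip] or [mid] at level [d], so [B] can be evaluated on the
     two-point frame, where it is valid. *)
  exfalso; apply: nBx.
  pose pt (b : bool) : V := if b then tip else mid.
  have ptP y : exists b : bool, rank_eqv adj e vs d y (pt b).
    have [] := @collapse W E mark (rank_eqv adj e vs)
      (fun _ _ _ _ => iff_refl _) _ _ _ d y hubP.
    - exact: rank_eqv_trans.
    - exact: rank_eqv_le.
    - exact: rank_eqv_step.
    - by exists true.
    - by exists false.
  have adj_pt (b b' : bool) : adj (pt b) (pt b') by case: b b' => [] [].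
  have [b xb] := ptP x.
  suff: forall A, {subset vars A <= vs} -> forall k, depth A <= k <= d ->
      forall y c, rank_eqv adj e vs k y (pt c) ->
      (sat adj e A y <-> sat full_rel (fun n c => e n (pt c)) A c).
    move=> /(_ B _ d) -> //; last exact: xb; last by rewrite leqnn.
    exact: LK2_sat.
  elim=> [n||A IHA C IHC|A IHA] sub k /andP[Ak kd] y c yc //=.
  - refine (rank_eqv_le (leq0n k) yc (A := Var n) _).
    by rewrite /= map_f // sub // inE.
  - move: Ak; rewrite /= geq_max => /andP[Ak Ck].
    rewrite (IHA _ k _ _ c) ?(IHC _ k _ _ c) ?Ak ?Ck // => n nA;
      by apply: sub; rewrite /= mem_cat nA ?orbT.
  - case: k Ak kd yc => // k Ak kd yc; have kd' := ltnW kd.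
    split=> [h c' _|h y' yy'].
      have [y' yy' y'c'] := rank_eqv_step (rank_eqv_sym yc) (adj_pt c c').
      apply/(IHA _ k _ y') => //; [by rewrite -ltnS Ak|exact: rank_eqv_sym|].
      exact: h.
    have [c' y'c'] := ptP y'.
    apply/(IHA _ k _ _ c') => //; [by rewrite -ltnS Ak| |exact: h].
    exact: rank_eqv_le y'c'.
(* Otherwise rigidity applies with all levels shifted by [3 + d], so the cell of [tip] contains
   nothing else. *)
have [c cF cP] := cellP adj e (rank_forms vs (9 + (3 + d))) tip.
exists c => //; apply: funext => y; apply/propext; rewrite cP.
split=> [yt|-> //].
apply: (@tip_rigid W E mark (fun k => rank_eqv adj e vs (k + (3 + d)))) => //.
- by move=> k ? ?; exact: rank_eqv_sym.
- by move=> k ? ? ?; exact: rank_eqv_trans.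
- by move=> j k ? ? jk; apply: rank_eqv_le; rewrite leq_add2r.
- by move=> k ? ? ?; exact: rank_eqv_step.
- by move=> h; apply: hubP; left.
- by move=> h; apply: hubP; right.
Qed.

Lemma gadget_logic_codimension3 : has_codimension 3 gadget_logic.
Proof.
(* The default value of [nth] is the entry at index three. *)
exists (fun i => nth gadget_logic [:: setT; Triv; LK2] i); split=> //.
  case=> [|[|[|[|//]]]] _ //=; last exact: gadget_logic_NExtKTB.
  - by apply: logic_of_NExtKTB.
  - by apply: logic_of_NExtKTB.
case=> [|[|[|//]]] _ /=.
- exact: covers_setT_Triv.
- exact: covers_Triv_LK2.
- exact: covers_LK2_gadget.
Qed.

End Codimension.

(** * Recovering the set of naturals from the logic *)

Section Recognition.
Variables (W : Type) (E : W -> W -> Prop) (mark : W -> bool).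
Local Notation V := (vertex W).
Local Notation adj := (adj E mark).
Implicit Types (x y : V) (a b : W).

(* These abstract the sets defined by [Var 0], [f_mid], [f_hub] and [f_leaf]
   (below) when [f_char] holds everywhere. *)
Variables L M Z K : V -> Prop.
Hypothesis disjoint : forall x, [/\ L x -> ~ M x, L x -> ~ Z x, L x -> ~ K x,
  M x -> ~ Z x & (M x -> ~ K x) /\ (Z x -> ~ K x)].
Hypothesis L_adj : forall x y, L x -> adj x y -> L y \/ M y.
Hypothesis L_M : forall x, L x -> exists2 y, adj x y & M y.
Hypothesis M_adj : forall x y, M x -> adj x y -> [\/ L y, M y | Z y].
Hypothesis M_L : forall x, M x -> exists2 y, adj x y & L y.
Hypothesis M_Z : forall x, M x -> exists2 y, adj x y & Z y.
Hypothesis Z_M : forall x, Z x -> exists2 y, adj x y & M y.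
Hypothesis Z_K : forall x, Z x -> exists2 y, adj x y & K y.
Hypothesis Z_other : forall x, Z x ->
  exists2 y, adj x y & [/\ ~ L y, ~ M y, ~ Z y & ~ K y].
Hypothesis K_adj : forall x y, K x -> adj x y -> K y \/ Z y.
Hypothesis K_Z : forall x, K x -> exists2 y, adj x y & Z y.

Local Ltac clash :=
  repeat match goal with
  | H : _ /\ _ |- _ => destruct H
  | H : [/\ _, _, _ & _] |- _ => destruct H
  end;
  repeat match goal with
  | H : L ?x |- _ => have [? ? ? ? [? ?]] := disjoint x; move: H
  | H : M ?x |- _ => have [? ? ? ? [? ?]] := disjoint x; move: H
  | H : Z ?x |- _ => have [? ? ? ? [? ?]] := disjoint x; move: H
  | H : K ?x |- _ => have [? ? ? ? [? ?]] := disjoint x; move: H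
  end; tauto.

Local Ltac nbrs H :=
  let y := fresh "y" in let hy := fresh "hy" in
  case: H => y hy; move: hy; case: y => [||||?|?|?] //= ? ?; subst.

(** A vertex in [M] has at least three neighbours, itself included, and one in [Z] at least four.
    The tip, the leaf and the buds have two; [mid] and unmarked stems have three. *)
Let tip_M : ~ M tip.
Proof. by move=> h; nbrs (M_L h); nbrs (M_Z h); clash. Qed.

Let tip_Z : ~ Z tip.
Proof. by move=> h; nbrs (Z_M h); nbrs (Z_K h); clash. Qed.

Let leaf_M : ~ M leaf.
Proof. by move=> h; nbrs (M_L h); nbrs (M_Z h); clash. Qed.

Let leaf_Z : ~ Z leaf.
Proof. by move=> h; nbrs (Z_M h); nbrs (Z_K h); clash. Qed.

Let bud_M a : ~ M (bud a).
Proof. by move=> h; nbrs (M_L h); nbrs (M_Z h); clash. Qed.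

Let bud_Z a : ~ Z (bud a).
Proof. by move=> h; nbrs (Z_M h); nbrs (Z_K h); clash. Qed.

Let mid_Z : ~ Z mid.
Proof. by move=> h; nbrs (Z_M h); nbrs (Z_K h); nbrs (Z_other h); clash. Qed.

Let stem_Z a : ~~ mark a -> ~ Z (stem a).
Proof.
move=> /negP ma h; nbrs (Z_M h); nbrs (Z_K h); nbrs (Z_other h); clash.
Qed.

Let stem_K a : ~ K (stem a).
Proof.
move=> h; case: (K_adj h (erefl : adj (stem a) (bud a))) => [h'|/bud_Z//].
by nbrs (K_Z h'); clash.
Qed.

Let stem_L a : ~ L (stem a).
Proof.
move=> h; case: (L_adj h (erefl : adj (stem a) (bud a))) => [h'|/bud_M//].
by nbrs (L_M h'); clash.
Qed.

(** All neighbours of a hub in [M] lie in [L], [M] or [Z]. Then a core vertex or marked stem in [Z]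
    lacks a neighbour in [K] or one outside the four sets, so the hub sees no vertex in [Z]. *)
Let hub_M : ~ M hub.
Proof.
move=> h.
have coreP a : ~ Z (core a).
  move=> ha; have hb b := M_adj h (I : adj hub (core b)).
  case: (Z_K ha) => -[||||b|b|b] //= hab hK; [clash| |exact: stem_K hK].
  by case: (hb b) => ?; clash.
have stemP a : mark a -> ~ Z (stem a).
  move=> ma ha; have hb := M_adj h (I : adj hub (core a)).
  nbrs (Z_other ha); [clash|by case: hb => ?; clash|clash|].
  by nbrs (Z_K ha); [clash|case: hb => ?; clash|clash|clash].
case: (M_Z h) => -[||||a|a|a] //= ha hz; first clash.
  exact: coreP hz.
exact: stemP hz.
Qed.

Let hub_L : ~ L hub.
Proof.
move=> h; have hubP y := @L_adj hub y h.
have coreP a : ~ Z (core a) by case: (hubP (core a) I) => ?; clash.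
have stemP a : ~ Z (stem a).
  case ma: (mark a); last by apply: stem_Z; rewrite ma.
  by case: (hubP (stem a) ma) => ?; clash.
case: (L_M h) => -[||||a|a|a] //= ha hM.
- by nbrs (M_Z hM); clash.
- case: (M_Z hM) => -[||||b|b|b] //= hab hZ.
  + clash.
  + exact: coreP hZ.
  + exact: stemP hZ.
- case: (M_Z hM) => -[||||b|b|b] //= hab hZ.
  + clash.
  + exact: coreP hZ.
  + exact: stemP hZ.
  + exact: bud_Z hZ.
Qed.

Let core_L a : ~ L (core a).
Proof. by move=> h; case: (L_adj h (I : adj (core a) hub)). Qed.

Let hub_K : ~ K hub.
Proof.
move=> h; case: (K_adj h (I : adj hub mid)) => // hm.
case: (K_adj hm (I : adj mid tip)) => // ht.
by nbrs (K_Z ht).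
Qed.

Let core_K a : ~ K (core a).
Proof.
move=> h; case: (K_adj h (erefl : adj (core a) (stem a))) => [/stem_K//|hZ].
have ma : mark a.
  by case ma: (mark a) => //; case: (@stem_Z a) => //; rewrite ma.
case: (Z_M hZ) => -[||||b|b|b] //= hab hM; subst; try clash.
exact: bud_M hM.
Qed.

(** The longest case is a bud in [L]: its stem lies in [M], so the adjacent core vertex lies in [L],
    [M] or [Z], and each choice lacks a required neighbour or is already excluded. *)
Lemma L_tip x : L x -> x = tip.
Proof.
case: x => [||||a|a|a] // h; exfalso.
- by nbrs (L_M h); clash.
- by nbrs (L_M h); clash.
- exact: core_L h.
- exact: stem_L h.
case: (L_M h) => -[||||b|b|b] //= hab hM; last exact: bud_M hM.
case: (M_adj hM (erefl : adj (stem b) (core b))) => [/core_L//|hM'|hZ].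
  case: (M_L hM') => -[||||c|c|c] //= _ hL; [exact: core_L hL|exact: stem_L hL].
case: (Z_K hZ) => -[||||c|c|c] //= _ hK; [exact: core_K hK|exact: stem_K hK].
Qed.

End Recognition.

(** * A formula characterising the tip *)

Definition f_leafish := And f_ring (Box (Or f_ring f_hub)).
(** With [Var 0] read as the tip, [f_leafish] also holds at marked core vertices. This second round
    removes them, since they see their stem, which is not leafish because of its bud. *)
Definition f_leaf := And f_ring (Box (Or f_hub f_leafish)).

(* Every nonempty set satisfying [f_char] everywhere is [{tip}]. *)
Definition f_char :=
  And (Imp (Var 0) (Dia f_mid))
  (And (Imp f_mid (Dia f_hub))
  (And (Imp f_hub (Dia f_leaf))
  (And (Imp f_hub (Dia (And f_ring (Neg f_leaf))))
       (Imp f_leaf (Box (Or f_leaf f_hub)))))).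

Section Characteristic.
Variables (W : Type) (E : W -> W -> Prop) (mark : W -> bool).
Hypothesis Esym : forall a b, E a b -> E b a.
Variable e : nat -> vertex W -> Prop.
Local Notation adj := (adj E mark).
Local Notation sat := (sat adj e).

Lemma f_char_tip x : (forall y, sat f_char y) -> e 0 x -> x = tip.
Proof.
move=> char.
have char1 y : e 0 y -> exists2 y', adj y y' & sat f_mid y'.
  by have /satAnd[h _] := char y; move=> hy; apply/satDia; exact: h hy.
have char2 y : sat f_mid y -> exists2 y', adj y y' & sat f_hub y'.
  have /satAnd[_ /satAnd[h _]] := char y.
  by move=> hy; apply/satDia; exact: h hy.
have char3 y : sat f_hub y -> exists2 y', adj y y' & sat f_leaf y'.
  have /satAnd[_ /satAnd[_ /satAnd[h _]]] := char y.
  by move=> hy; apply/satDia; exact: h hy.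
have char4 y : sat f_hub y ->
    exists2 y', adj y y' & sat f_ring y' /\ ~ sat f_leaf y'.
  have /satAnd[_ /satAnd[_ /satAnd[_ /satAnd[h _]]]] := char y.
  move=> hy; have /satDia[y' yy' /satAnd ?] :
    sat (Dia (And f_ring (Neg f_leaf))) y := h hy.
  by exists y'.
have char5 y y' : sat f_leaf y -> adj y y' -> sat f_leaf y' \/ sat f_hub y'.
  have /satAnd[_ /satAnd[_ /satAnd[_ /satAnd[_ h]]]] := char y.
  by move=> hy yy'; apply/satOr; exact: h hy _ yy'.
have midP y : sat f_mid y <-> (exists2 y', adj y y' & e 0 y') /\ ~ e 0 y.
  by rewrite satAnd satDia.
have hubP y : sat f_hub y <->
    (exists2 y', adj y y' & sat f_mid y') /\ ~ sat f_mid y /\ ~ e 0 y.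
  by rewrite (satAnd _ _ (Dia f_mid)) (satAnd _ _ (Neg f_mid)) satDia.
have ringP y : sat f_ring y <->
    (exists2 y', adj y y' & sat f_hub y') /\
    ~ sat f_hub y /\ ~ sat f_mid y /\ ~ e 0 y.
  by rewrite (satAnd _ _ (Dia f_hub)) (satAnd _ _ (Neg f_hub))
    (satAnd _ _ (Neg f_mid)) satDia.
have leafP y : sat f_leaf y -> sat f_ring y by move=> /satAnd[].
apply: (@L_tip W E mark (e 0) (sat f_mid) (sat f_hub) (sat f_leaf)) => //.
- move=> y; split; do ?[by move=> ? /midP[] | by move=> ? /hubP[? []]].
  + by move=> ? /leafP/ringP[? [? []]].
  + split; by move=> ? /leafP/ringP[? [? []]].
- move=> y y' ey yy'; have [?|ney'] := pselect (e 0 y'); first by left.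
  by right; apply/midP; split=> //; exists y => //; exact: adj_sym.
- move=> y y' my yy'; have [?|ney'] := pselect (e 0 y'); first by constructor 1.
  have [?|nmy'] := pselect (sat f_mid y'); first by constructor 2.
  constructor 3; apply/hubP; split=> //; exists y => //; exact: adj_sym.
- by move=> y /midP[].
- by move=> y /hubP[].
- by move=> y /char4[y' yy' [/ringP[_ [? [? ?]]] ?]]; exists y'.
- by move=> y /leafP/ringP[].
Qed.

Hypothesis e0 : e 0 = @is_tip W.

Lemma sat_leafish :
  sat f_leafish =
    (fun x => match x with leaf => True | core a => mark a | _ => False end).
Proof.
apply: funext => x; apply/propext; rewrite /f_leafish satAnd sat_ring //.
split=> [[rx box]|].
  have {}box y : adj x y -> is_ring mark y \/ y = hub.
    move=> xy; have /satOr : sat (Or f_ring f_hub) y := box y xy.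
    by rewrite sat_ring // sat_hub.
  case: x rx box => [||||a|a|a] //= ma box.
  - by case: (box (stem a) erefl).
  - by case: (box (bud a) erefl).
move=> lx; have rx : is_ring mark x by case: x lx.
split=> // y xy; change (sat (Or f_ring f_hub) y).
apply/satOr; rewrite sat_ring // sat_hub //.
case: x y lx rx xy => [||||a|a|a] [||||b|b|b] //= ma _ ab;
  try (by left); try by right.
by left; rewrite -ab.
Qed.

Lemma sat_leaf : sat f_leaf = (fun x => x = leaf).
Proof.
apply: funext => x; apply/propext; rewrite /f_leaf satAnd sat_ring //.
split=> [[rx box]|->].
  have {}box y : adj x y -> y = hub \/ sat f_leafish y.
    move=> xy; have /satOr : sat (Or f_hub f_leafish) y := box y xy.
    by rewrite sat_hub.
  rewrite sat_leafish in box.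
  case: x rx box => [||||a|a|a] //= ma box.
  - by case: (box (stem a) erefl).
  - by case: (box (bud a) erefl).
split=> // y xy; change (sat (Or f_hub f_leafish) y).
apply/satOr; rewrite sat_hub // sat_leafish.
by case: y xy => //= _; [left|right].
Qed.

Lemma sat_char (a : W) x : sat f_char x.
Proof.
have tipP := sat_tip E mark e0; have midP := sat_mid E mark e0.
have hubP := sat_hub E mark e0.
rewrite /f_char !satAnd; split; [|split; [|split; [|split]]].
- change (sat (Var 0) x -> sat (Dia f_mid) x); rewrite tipP => ->.
  by apply/satDia; rewrite midP; exists mid.
- change (sat f_mid x -> sat (Dia f_hub) x); rewrite midP => ->.
  by apply/satDia; rewrite hubP; exists hub.
- change (sat f_hub x -> sat (Dia f_leaf) x); rewrite hubP => ->.
  by apply/satDia; rewrite sat_leaf; exists leaf.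
- change (sat f_hub x -> sat (Dia (And f_ring (Neg f_leaf))) x).
  rewrite hubP => ->; apply/satDia; exists (core a) => //.
  by apply/satAnd; rewrite satNeg sat_ring // sat_leaf.
- change (sat f_leaf x -> forall y, adj x y -> sat (Or f_leaf f_hub) y).
  rewrite sat_leaf => -> y xy; apply/satOr; rewrite hubP sat_leaf.
  by case: y xy => //= _; [right|left].
Qed.

End Characteristic.

(** * Coding sets of naturals into the core *)

Fixpoint f_reach (k : nat) : form :=
  match k with
  | 0 => And f_leafish (Neg f_leaf)
  | k'.+1 => And f_ring (Dia (f_reach k'))
  end.

(** With [Var 0] read as the tip, [f_reach 0] holds at the marked path starts, and this formula at
    the ends of paths of length [n.+2] from them. As [n.+1] is positive, marked stems, reached after
    one step, do not qualify. *)
Definition f_end (n : nat) : form :=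
  And (f_reach n.+2) (And (Neg (f_reach n.+1))
    (Neg (Dia (And f_ring (Neg (f_reach n.+2)))))).

(** With [iter 6 Box] as universal modality, the antecedents force [Var 0] to denote exactly the
    tip, so validity depends on the graph alone. *)
Definition f_test (n : nat) : form :=
  Imp (Var 0) (Imp (iter 6 Box f_char) (iter 6 Box (Neg (f_end n)))).

Section Coding.
Variable X : set nat.

(* The core vertices [(n, 0), ..., (n, n + 2)] form a path, and its end
   [(n, 0)] is marked when [n] lies in [X]. *)
Definition path_adj (a b : nat * nat) : Prop :=
  a.1 = b.1 /\ (a.2 = b.2 \/
    [/\ a.2 <= a.1.+2, b.2 <= b.1.+2 & a.2 = b.2.+1 \/ b.2 = a.2.+1]).

Definition path_mark (a : nat * nat) : bool := (a.2 == 0) && `[< X a.1 >].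

Lemma path_adjxx a : path_adj a a.
Proof. by split=> //; left. Qed.

Lemma path_adj_sym a b : path_adj a b -> path_adj b a.
Proof.
by move=> [? [?|[? ? ?]]]; split=> //; [left|right; split=> //; tauto].
Qed.

Definition coded_logic := gadget_logic path_adj path_mark.

Section Reach.
Variable e : nat -> vertex (nat * nat) -> Prop.
Hypothesis e0 : e 0 = @is_tip (nat * nat).
Local Notation sat := (sat (adj path_adj path_mark) e).

Lemma sat_reach k : sat (f_reach k) = (fun x => match x with
  | core a => [/\ X a.1, a.2 <= k & a.2 <= a.1.+2]
  | stem a => [/\ X a.1, a.2 = 0 & 0 < k]
  | _ => False end).
Proof.
elim: k => [|k IH]; apply: funext => x; apply/propext; rewrite [f_reach _]/=.
  rewrite satAnd satNeg sat_leafish // sat_leaf //.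
  case: x => [||||[n i]|[n i]|a] /=; do ?by [split=> [[]|]|split=> [[]|[]]].
  rewrite /path_mark /=; split=> [[/andP[/eqP -> /asboolP]]|[Xn]].
    by split.
  by rewrite leqn0 => /eqP -> _; split=> //; rewrite eqxx; apply/asboolP.
rewrite satAnd satDia IH sat_ring //.
case: x => [||||[n i]|[n i]|a] /=; do ?by [split=> [[]|]].
- by split=> // -[_ [[]]].
- split=> [[_ [[||||[m j]|[m j]|b] //=]]|[Xn ik ni]].
  + rewrite /path_adj /= => -[-> [->|[h1 h2 h3]]] [Xm jk jm]; split=> //; lia.
  + by move=> [-> ->] [Xm -> k0].
  + split=> //; case: (leqP i k) => ik'.
      by exists (core (n, i)) => //; exact: path_adjxx.
    exists (core (n, k)); last by split=> //=; lia.
    by rewrite /path_adj /=; split=> //; right; split; lia.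
- rewrite /path_mark /=; split=> [[/andP[/eqP -> /asboolP Xn] _]|[Xn -> _]].
    by split.
  by split; [rewrite eqxx; apply/asboolP|exists (core (n, 0))].
Qed.

Lemma sat_endE n x : sat (f_end n) x <->
  [/\ sat (f_reach n.+2) x, ~ sat (f_reach n.+1) x &
    forall y, adj path_adj path_mark x y -> is_ring path_mark y ->
      sat (f_reach n.+2) y].
Proof.
rewrite -(sat_ring path_adj path_mark e0) /f_end.
move: (f_reach n.+2) (f_reach n.+1) f_ring => A B C.
rewrite !satAnd satNeg (satNeg _ _ (Dia _)) satDia.
split=> [[hA [hB hC]]|[hA hB hC]].
  split=> // y xy Cy; apply: contrapT => nAy; apply: hC; exists y => //.
  exact/satAnd.
by split=> //; split=> // -[y xy /satAnd[Cy]]; apply; exact: hC.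
Qed.

Lemma sat_end n : (exists x, sat (f_end n) x) <-> X n.
Proof.
split=> [[x /sat_endE]|Xn].
  rewrite !sat_reach.
  case: x => [||||[m i]|[m i]|a] [] //= [Xm im mi] nr nd.
  have im' : i = n.+2.
    by apply/eqP; apply: contrapT => /eqP h; apply: nr; split=> //; lia.
  have [-> //|nm] := eqVneq n m; exfalso.
  (* For [m] other than [n] the path of [m] is longer, and its next vertex is a ring neighbour not
     yet reached. *)
  have [] := nd (core (m, n.+3)) _ I; last by move=> _ /=; lia.
  by rewrite /path_adj /=; split=> //; right; split; lia.
exists (core (n, n.+2)); apply/sat_endE; rewrite !sat_reach /=; split.
- by split.
- by move=> [_]; lia.
case=> [||||[m i]|[m i]|a] //=; rewrite /path_adj /=; last by move=> [<- <-].
by move=> [<- h] _; split=> //; case: h => [<-|[]]; lia.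
Qed.

End Reach.

Lemma f_test_coded n : coded_logic (f_test n) <-> ~ X n.
Proof.
split=> [h Xn|nXn s x].
  have [x ex] : exists x, sat (adj path_adj path_mark)
      (fun=> @is_tip (nat * nat)) (f_end n) x by exact/sat_end.
  have nend : sat (adj path_adj path_mark)
      (fun=> @is_tip (nat * nat)) (iter 6 Box (Neg (f_end n))) tip.
    have := h Var tip; rewrite sat_subst; apply=> //.
    change (sat (adj path_adj path_mark) (fun=> @is_tip (nat * nat))
      (iter 6 Box f_char) tip).
    apply: sat_iterBox_all => y.
    exact: (@sat_char _ path_adj path_mark (fun=> @is_tip _) erefl (0, 0)).
  exact: (sat_iterBox path_adjxx x nend ex).
rewrite sat_subst; set e := (fun n => _) => ex char.
have e0 : e 0 = @is_tip (nat * nat).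
  have tipP y : e 0 y -> y = tip.
    apply: (f_char_tip path_adj_sym) => y'.
    exact: (@sat_iterBox _ _ _ path_adjxx e f_char x y' char).
  apply: funext => y; apply/propext; split=> [/tipP //|->].
  by rewrite -(tipP _ ex).
apply: (@sat_iterBox_all _ _ _ 6 (Neg (f_end n))) => y hend.
by apply: nXn; apply/(sat_end e0); exists y.
Qed.

End Coding.

(** * Counting the logics *)

Lemma coded_logic_inj : injective coded_logic.
Proof.
move=> X Y eqXY; apply: funext => n; apply/propext.
have : ~ X n <-> ~ Y n by rewrite -!f_test_coded eqXY.
by move=> h; split=> ?; apply: contrapT => /h.
Qed.

Lemma set_form_card_le (S : set (set form)) : S #<= [set: set nat].
Proof.
apply/pcard_injP; exists (fun L => form_code @` L) => L L' _ _ /= eqLL'.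
apply: funext => A.
by rewrite -(image_inj form_code_inj) eqLL' image_inj //; exact: form_code_inj.
Qed.

Theorem theorem4p1 :
  [set L : set form | NExtKTB L /\ has_codimension 3 L] #= [set: set nat].
Proof.
apply: Cantor_Bernstein; first exact: set_form_card_le.
apply/card_subP; exists (coded_logic @` [set: set nat]).
  by apply: inj_card_eq => X Y _ _; exact: coded_logic_inj.
move=> _ [X _ <-]; split.
  exact: gadget_logic_NExtKTB path_adjxx path_adj_sym.
exact: gadget_logic_codimension3 path_adjxx path_adj_sym.
Qed.
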